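(* There exists a partition of $\mathbb R$ into two sets $A,B$ such that each of $A$ and $B$ is a Bernstein set and neither $A$ nor $B$ is a $2$-covering.
   Context: A set $B\subseteq\mathbb R$ is a Bernstein set if for every uncountable Borel set $Z\subseteq\mathbb R$ both $Z\cap B$ and $Z\setminus B$ are nonempty. For a cardinal $\kappa$, a set $A\subseteq\mathbb R$ is a $\kappa$-covering if for every $B\subseteq\mathbb R$ with $|B|=\kappa$ there is $x\in\mathbb R$ with $B+x\subseteq A$. *)

(* Defs.v *)
From mathcomp Require Import all_boot all_order all_algebra.
From mathcomp Require Import all_classical all_reals all_analysis.
Set Implicit Arguments. Unset Strict Implicit. Unset Printing Implicit Defensive.
Import Order.TTheory GRing.Theory Num.Theory.
Local Open Scope classical_set_scope.
Local Open Scope ring_scope.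

(* Borel sets of R: the canonical measurable structure on a realType R
   (sigma-algebra generated by the half-open intervals), i.e. [measurable]. *)

Definition bernstein (R : realType) (B : set R) : Prop :=
  forall Z : set R, measurable Z -> ~ countable Z ->
    Z `&` B !=set0 /\ Z `\` B !=set0.

(* A is a kappa-covering, for kappa given as a cardinality witness type K:
   every B with |B| = |K| has a translate B + x contained in A. *)
Definition covering (R : realType) (K : Type) (A : set R) : Prop :=
  forall B : set R, (B #= [set: K])%card ->
    exists x : R, [set b + x | b in B] `<=` A.

Definition two_covering (R : realType) (A : set R) : Prop :=
  covering 'I_2 A.

(* Main.v *)
(** If [A] meets exactly one of [x] and [x + 1] for every [x], then neither [A]
    nor its complement contains a translate of the two-point set [{0, 1}].
    Such an [A] is obtained from any Bernstein set [C] by repeating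
    [C `&` [0, 1[] and its complement on alternate unit intervals; it is again
    Bernstein because an uncountable Borel set has an uncountable trace on some
    [[n, n + 1[].

    For the existence of [C]: every Borel set is the result of a Souslin
    operation on closed sets, hence is coded by an element of [nat -> bool], and
    when uncountable it contains a copy of [nat -> bool] by a Cantor scheme.
    A transfinite choice along a well-order of the codes whose proper initial
    segments are small then picks distinct points, two in each uncountable
    coded set; one is put in [C], the other outside. *)
Require Import Defs.
From mathcomp Require Import all_boot all_order all_algebra.
From mathcomp Require Import all_classical all_reals all_analysis.
From mathcomp Require Import measurable_realfun lra zify.
From mathcomp Require wochoice.
From Stdlib Require Wellfounded.
Set Implicit Arguments. Unset Strict Implicit. Unset Printing Implicit Defensive.
Import Order.TTheory GRing.Theory Num.Theory.
Import numFieldNormedType.Exports.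
Local Open Scope classical_set_scope.
Local Open Scope ring_scope.

(** * Choosing distinct points in large sets *)

Lemma well_founded_minimal {I : Type} {lt : I -> I -> Prop} (P : set I) :
  well_founded lt -> P !=set0 -> exists2 i, P i & forall j, lt j i -> ~ P j.
Proof.
move=> wf [i]; elim/(well_founded_ind wf): i => i IH Pi.
have [[j [ltji Pj]]|no] := pselect (exists j, lt j i /\ P j); first exact: IH Pj.
by exists i => // j ltji Pj; apply: no; exists j.
Qed.

Lemma exists_well_order (I : Type) : exists lt : I -> I -> Prop,
  well_founded lt /\ forall i j, [\/ i = j, lt i j | lt j i].
Proof.
have [R woR] := wochoice.well_ordering_principle {classic I}.
exists (fun i j => ~ R j i); split.
  move=> i; apply: contrapT => nacc.
  have [|z [[zA lbz] _]] := woR [pred x | `[< ~ Acc (fun i j => ~ R j i) x >]].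
    by exists i; exact/asboolP.
  move/asboolP: zA; apply; constructor => y nRzy.
  by apply: contrapT => nay; apply/nRzy/lbz/asboolP.
move=> i j; have [Rij|] := pselect (R i j); last by constructor 3.
have [Rji|] := pselect (R j i); last by constructor 2.
constructor 1; apply: (wochoice.wo_chain_antisymmetric (fun A _ => woR A) (C := predT)) => //.
by rewrite Rij Rji.
Qed.

(* Transport a well-order back from its least initial segment that embeds [I]. *)
Lemma exists_initial_well_order (I : Type) : exists lt : I -> I -> Prop,
  [/\ well_founded lt, forall i j, [\/ i = j, lt i j | lt j i] &
      forall i (g : I -> I), injective g -> ~ forall j, lt (g j) i].
Proof.
have [lt [wf tot]] := exists_well_order I.
pose big i := exists2 g : I -> I, injective g & forall j, lt (g j) i.
have [nbig|no] := pselect (big !=set0); last first.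
  by exists lt; split=> // i g ginj gi; apply: no; exists i, g.
have [i0 [g ginj gi0] mini0] := well_founded_minimal wf nbig.
exists (fun j k => lt (g j) (g k)); split.
- exact: Inverse_Image.wf_inverse_image.
- move=> i j; have [/ginj|lij|lji] := tot (g i) (g j).
  + by constructor 1.
  + by constructor 2.
  + by constructor 3.
(* Composing [h] with [g] would embed [I] below [g i], which lies below the minimal [i0]. *)
- move=> i h hinj hi; apply: (mini0 (g i)) => //.
  by exists (g \o h) => //; exact: inj_comp.
Qed.

(** Transfinite recursion: the points used before stage [i] are indexed by the initial segment below
    [i], too small to exhaust a copy of [I] inside [Z i]. *)
Lemma injective_choice (I X : Type) (Z : I -> set X) :
  (forall i, exists2 f : I -> X, injective f & forall j, Z i (f j)) ->
  exists2 s : I -> X, injective s & forall i, Z i (s i).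
Proof.
move=> embZ; have [lt [wf tot small]] := exists_initial_well_order I.
pose good i (prev : forall j, lt j i -> X) x :=
  Z i x /\ forall j (ltji : lt j i), prev j ltji <> x.
have step i prev : exists x, good i prev x.
  apply: contrapT => no.
  have [f finj fZ] := embZ i.
  (* If every [f j] were taken, [g] would send [j] to a stage that took it; since [f] is injective,
     this embeds [I] below [i]. *)
  have /choice[g gP] (j : I) : exists k, exists ltki : lt k i, prev k ltki = f j.
    apply: contrapT => nok; apply: no; exists (f j); split=> // k ltki e.
    by apply: nok; exists k, ltki.
  apply: (small i g) => [j k gjk|j]; last by have [] := gP j.
  have [l1 e1] := gP j; have [l2 e2] := gP k.
  apply: finj; rewrite -e1 -e2; move: l1 l2 {e1 e2}; rewrite gjk => l1 l2.
  by congr prev; exact: Prop_irrelevance.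
pose F i prev := projT1 (cid (step i prev)).
pose s := Fix wf (fun=> X) F.
have sP i : good i (fun j _ => s j) (s i).
  rewrite {2}/s Fix_eq; first by rewrite /F; case: cid.
  by move=> x f g fg; congr F; apply: functional_extensionality_dep => y;
     apply: functional_extensionality_dep.
exists s; last by move=> i; have [] := sP i.
move=> i j sij; have [//|lij|lji] := tot i j.
  by have [_ /(_ _ lij)] := sP j.
by have [_ /(_ _ lji)] := sP i; rewrite sij.
Qed.

(** * Souslin representation of Borel sets *)

Definition rat_itv (R : realType) (k : nat) : set R :=
  if @unpickle (rat * rat)%type k is Some p
  then `]ratr p.1, ratr p.2[%classic else set0.

Arguments rat_itv : clear implicits.

Lemma rat_itv_open (R : realType) k : open (@rat_itv R k).
Proof.
rewrite /rat_itv; case: unpickle => [p|]; last exact: open0.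
exact: interval_open.
Qed.

Lemma rat_itv_basis (R : realType) (x e : R) : 0 < e ->
  exists k, rat_itv R k x /\ rat_itv R k `<=` `]x - e, x + e[%classic.
Proof.
move=> e0; have [a] : exists q : rat, ratr q \in `]x - e, x[.
  by apply: rat_in_itvoo; lra.
have [b] : exists q : rat, ratr q \in `]x, x + e[.
  by apply: rat_in_itvoo; lra.
rewrite !in_itv /= => /andP[xb be] /andP[ea ax].
exists (pickle (a, b)); rewrite /rat_itv pickleK /=; split.
  by rewrite /= in_itv /= ax xb.
move=> z; rewrite /= !in_itv /= => /andP[az zb].
by rewrite (lt_trans ea az) (lt_trans zb be).
Qed.

(* The Souslin operation on the closed sets coded by [c]: [c s k] says that
   the closed set attached to [s] misses the [k]-th rational interval. *)
Definition souslin (R : realType) (c : seq nat -> nat -> Prop) : set R :=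
  [set x | exists y : nat -> nat,
     forall n k, c (mkseq y n) k -> ~ rat_itv R k x].

Lemma open_ball_itv {R : realType} {V : set R} {x : R} : open V -> V x ->
  exists2 e, 0 < e & `]x - e, x + e[%classic `<=` V.
Proof.
move=> oV Vx; have /nbhs_ballP[e /= e0 eV] : nbhs x V by exact: open_nbhs_nbhs.
exists e => // z; rewrite /= in_itv /= => /andP[xz zx]; apply: eV.
by rewrite /ball /= ltr_norml; apply/andP; split; lra.
Qed.

Arguments souslin : clear implicits.

(** The code is the same at every sequence: it forbids all rational intervals missing [Z], and each
    point outside [Z] lies in one of them. *)
Lemma souslin_closed (R : realType) (Z : set R) : closed Z ->
  exists c, Z = souslin R c.
Proof.
move=> cZ; exists (fun _ k => Z `&` rat_itv R k = set0).
apply/seteqP; split=> [x Zx|x [y yx]].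
  by exists (fun=> 0%N) => n k; apply: contraPnot => Ukx; apply/eqP/set0P; exists x.
apply: contrapT => nZx.
have [e e0 eZ] := open_ball_itv (closed_openC cZ) nZx.
have [k [Ukx Uke]] := @rat_itv_basis R x e e0.
apply: (yx 0%N k) Ukx; apply/seteqP; split=> // z [Zz /Uke /eZ]; exact.
Qed.

(** The first entry of a branch selects the set [i]; the rest is a branch for [c i]. *)
Lemma souslin_bigcup (R : realType) (c : nat -> seq nat -> nat -> Prop) :
  exists c', \bigcup_i souslin R (c i) = souslin R c'.
Proof.
exists (fun s k => if s is i :: s' then c i s' k else False).
have mkS y n : mkseq y n.+1 = y 0%N :: mkseq (y \o S) n.
  by rewrite /mkseq /= -(addn0 1%N) iotaDl -map_comp.
apply/seteqP; split=> [x [i _ [y yx]]|x [y yx]].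
  exists (fun n => if n is m.+1 then y m else i) => -[//|n] k.
  by rewrite mkS => /yx.
by exists (y 0%N) => //; exists (y \o S) => n k cnk; apply: (yx n.+1); rewrite mkS.
Qed.

(** A single branch [y] encodes a branch for each [i], namely [m] mapped to [y (pr i m)]. A finite
    sequence imposes the conditions of [c i] on exactly those prefixes that it is long enough to
    determine. *)
Lemma souslin_bigcap (R : realType) (c : nat -> seq nat -> nat -> Prop) :
  exists c', \bigcap_i souslin R (c i) = souslin R c'.
Proof.
pose pr (i m : nat) := pickle (i, m).
exists (fun s k => exists i n, (forall m, (m < n)%N -> (pr i m < size s)%N) /\
  c i (mkseq (fun m => nth 0%N s (pr i m)) n) k).
apply/seteqP; split=> [x xc|x [y yx] i _].
  have /choice[y yP] i := xc i I.
  exists (fun j => if @unpickle (nat * nat)%type j is Some p then y p.1 p.2 else 0%N).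
  move=> N k [i [n [small cink]]]; apply: (yP i n).
  suff <- : mkseq (fun m => nth 0%N (mkseq (fun j => if @unpickle (nat * nat)%type j
    is Some p then y p.1 p.2 else 0%N) N) (pr i m)) n = mkseq (y i) n by [].
  apply/eq_in_map => m; rewrite mem_iota add0n /= => mn.
  have := small _ mn; rewrite size_mkseq => prN.
  by rewrite nth_mkseq // /pr pickleK.
exists (fun m => y (pr i m)) => n k cink.
pose N := \max_(m < n) (pr i m).+1.
have prN m : (m < n)%N -> (pr i m < N)%N.
  by move=> mn; exact: (leq_bigmax (Ordinal mn)).
apply: (yx N k); exists i, n; split=> [m mn|]; first by rewrite size_mkseq prN.
suff -> : mkseq (fun m => nth 0%N (mkseq y N) (pr i m)) n =
   mkseq (fun m => y (pr i m)) n by [].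
apply/eq_in_map => m; rewrite mem_iota add0n /= => mn.
by rewrite nth_mkseq // prN.
Qed.

Lemma measurable_souslin (R : realType) (Z : set R) : measurable Z ->
  exists c, Z = souslin R c.
Proof.
(* Souslin sets need not be stable under complement, so the induction over the sigma-algebra carries
   [Z] and its complement together. *)
suff : measurable Z -> (exists c, Z = souslin R c) /\ (exists c, ~` Z = souslin R c).
  by move=> /[apply] -[].
have -> : measurable Z = (@RGenOInfty.G R).-sigma.-measurable Z.
  by rewrite -RGenOInfty.measurableE.
move: Z; apply: smallest_sub; last first.
  move=> _ [x ->]; split; last first.
    by rewrite setCitvr; apply: souslin_closed; exact: interval_closed.
  have /choice[c cP] n := souslin_closed
    (@interval_closed R (BLeft (x + n.+1%:R^-1)) +oo%O isT isT).
  by rewrite itvoyEbigcup (eq_bigcupr (fun i _ => cP i)); exact: souslin_bigcup.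
split.
- split; first exact/souslin_closed/closed0.
  by rewrite setC0; exact/souslin_closed/closedT.
- by move=> A [A1 A2]; rewrite setTD setCK.
- move=> A /all_and2[A1 A2]; split.
    have [c cP] := choice A1.
    by rewrite (eq_bigcupr (fun i _ => cP i)); exact: souslin_bigcup.
  have [c cP] := choice A2; rewrite setC_bigcup.
  by rewrite (eq_bigcapr (fun i _ => cP i)); exact: souslin_bigcap.
Qed.

(** * Perfect set theorem *)

Lemma uncountable_setI_itv (R : realType) (A : set R) : ~ countable A ->
  exists n : nat, ~ countable (A `&` `[- n%:R, n%:R]%classic).
Proof.
move=> uncA; apply: contrapT => no; apply: uncA.
have -> : A = \bigcup_n (A `&` `[- n%:R, n%:R]%classic).
  rewrite -setI_bigcupr; apply/esym/setIidPl => x _.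
  exists (Num.bound `|x|) => //.
  have := archi_boundP (normr_ge0 x); rewrite /= in_itv /= -ler_norml.
  exact: ltW.
apply: bigcup_countable => // n _; apply: contrapT => nc; apply: no.
by exists n.
Qed.

Definition condensation (R : realType) (A : set R) (x : R) :=
  forall e, 0 < e -> ~ countable (A `&` `[x - e, x + e]%classic).

(** Each such point lies in a rational interval with countable trace on [A], and there are countably
    many rational intervals. *)
Lemma countable_noncondensation (R : realType) (A : set R) :
  countable (A `\` condensation A).
Proof.
pose D := [set k | countable (A `&` rat_itv R k)].
apply: (@sub_countable _ _ _ (\bigcup_(k in D) (A `&` rat_itv R k))); last first.
  by apply: bigcup_countable => //; exact: countableP.
apply: subset_card_le => x [Ax /existsNP[e /not_implyP[e0 /contrapT ce]]].
have [k [Ukx Uke]] := rat_itv_basis x e0.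
exists k; last by split.
apply: sub_countable ce; apply: subset_card_le => z [Az /Uke].
rewrite /= !in_itv /= => /andP[/ltW-> /ltW->]; by split.
Qed.

Lemma uncountable_split (R : realType) (A : set R) (e : R) :
  ~ countable A -> 0 < e ->
  exists p q d, [/\ 0 < d, d <= e, p + d < q - d,
    ~ countable (A `&` `[p - d, p + d]%classic) &
    ~ countable (A `&` `[q - d, q + d]%classic)].
Proof.
move=> uncA e0.
have uncC : ~ countable (A `&` condensation A).
  move=> c; apply: uncA.
  have -> : A = \bigcup_(b in [set: bool])
      if b then A `&` condensation A else A `\` condensation A.
    apply/seteqP; split=> [x Ax|x [[] _ []]] //.
    by have [Cx|nCx] := pselect (condensation A x); [exists true|exists false].
  apply: bigcup_countable => // -[] _ //; exact: countable_noncondensation.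
have [p [Ap cp]] : (A `&` condensation A) !=set0.
  by apply/set0P/eqP => e1; apply: uncC; rewrite e1.
have [q [[Aq cq] pq]] : ((A `&` condensation A) `\` [set p]) !=set0.
  apply/set0P/eqP; rewrite setD_eq0 => sub; apply: uncC.
  by apply: sub_countable (countable1 p); exact: subset_card_le.
wlog lpq : p q {Ap Aq} cp cq pq / p < q.
  move=> wl; have [qp|pq'|//] := ltgtP q p.
    by apply: (wl q p) => // e1; apply: pq.
  exact: (wl p q).
(* A radius of at most a third of the gap keeps the intervals around the condensation points [p] and
   [q] disjoint. *)
have d0 : 0 < Num.min e ((q - p) / 3) by rewrite lt_min e0 /=; lra.
exists p, q, (Num.min e ((q - p) / 3)); split; rewrite ?ge_min ?lexx //.
- have : Num.min e ((q - p) / 3) <= (q - p) / 3 by rewrite ge_min lexx orbT.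
  by lra.
- exact: cp.
- exact: cq.
Qed.

Section cantor_scheme.
Context (R : realType) (c : seq nat -> nat -> Prop).

Let souslin_from (s : seq nat) : set R :=
  [set x | exists2 y : nat -> nat, mkseq y (size s) = s &
     forall n k, c (mkseq y n) k -> ~ rat_itv R k x].

(** A node of the Cantor scheme: a finite piece of a Souslin branch and the endpoints of a closed
    interval. *)
Let node : Type := seq nat * (R * R).

Let piece (t : node) : set R := souslin_from t.1 `&` `[t.2.1, t.2.2]%classic.

Let child (e : R) (t u : node) :=
  [/\ exists k, u.1 = rcons t.1 k, t.2.1 <= u.2.1, u.2.2 <= t.2.2 &
      u.2.2 - u.2.1 <= e].

Let souslin_from_bigcup s : souslin_from s = \bigcup_k souslin_from (rcons s k).
Proof.
apply/seteqP; split=> [x [y ys yx]|x [k _ [y ys yx]]].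
  exists (y (size s)) => //; exists y => //.
  by rewrite size_rcons mkseqS ys.
exists y => //; move: ys; rewrite size_rcons mkseqS => /eqP.
by rewrite eqseq_rcons => /andP[/eqP].
Qed.

(** The trace of the piece is a countable union over the next entry [k] of the branch, so some [k]
    keeps it uncountable. *)
Let exists_child (t : node) (p d : R) :
  ~ countable (piece t `&` `[p - d, p + d]%classic) ->
  exists u, [/\ ~ countable (piece u), child (2 * d) t u,
    p - d <= u.2.1 & u.2.2 <= p + d].
Proof.
case: t => s [a b] unc.
pose a' := Num.max a (p - d); pose b' := Num.min b (p + d).
have [k uk] : exists k, ~ countable (piece (rcons s k, (a', b'))).
  apply: contrapT => no; apply: unc.
  have -> : piece (s, (a, b)) `&` `[p - d, p + d]%classic =
      \bigcup_k piece (rcons s k, (a', b')).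
    rewrite /piece /= -setI_bigcupl -souslin_from_bigcup -setIA; congr (_ `&` _).
    apply/seteqP; split=> z; rewrite /= !in_itv /= ge_max le_min.
      by move=> [/andP[-> ->] /andP[-> ->]].
    by move=> /andP[/andP[-> ->] /andP[-> ->]].
  apply: bigcup_countable => // k _; apply: contrapT => nc; apply: no.
  by exists k.
have pa : p - d <= a' by rewrite le_max lexx orbT.
have pb : b' <= p + d by rewrite ge_min lexx orbT.
exists (rcons s k, (a', b')); split=> //; split=> /=.
- by exists k.
- by rewrite le_max lexx.
- by rewrite ge_min lexx.
- by lra.
Qed.

Let exists_children (e : R) (t : node) : 0 < e -> ~ countable (piece t) ->
  exists u : bool -> node, (forall b, ~ countable (piece (u b)) /\ child e t (u b)) /\
    (u false).2.2 < (u true).2.1.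
Proof.
move=> e0 unc; have [|p [q [d [d0 de pq up uq]]]] := uncountable_split (e := e / 2) unc.
  by lra.
have [u0 [un0 [k0 a0 b0 l0] _ r0]] := exists_child up.
have [u1 [un1 [k1 a1 b1 l1] r1 _]] := exists_child uq.
exists (fun b => if b then u1 else u0); split; last by lra.
by case; split=> //; split=> //; lra.
Qed.

(** Each [f] selects a path of nodes with uncountable pieces. Its intervals shrink to the point
    [h f], while its sequences grow to a branch that witnesses membership of [h f]. *)
Lemma souslin_uncountable_embed : ~ countable (souslin R c) ->
  exists2 h : (nat -> bool) -> R, injective h & forall f, souslin R c (h f).
Proof.
move=> unc.
have [N uncN] := uncountable_setI_itv unc.
pose big := {t : node | ~ countable (piece t)}.
have root_big : ~ countable (piece ([::], (- N%:R, N%:R))).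
  suff -> : piece ([::], (- N%:R, N%:R)) =
    souslin R c `&` `[- N%:R, N%:R]%classic by [].
  congr (_ `&` _); apply/seteqP; split=> x [y].
    by move=> _ yx; exists y.
  by exists y.
have step (nt : nat * big) : exists u : bool -> big,
    (forall b, child nt.1.+1%:R^-1 (sval nt.2) (sval (u b))) /\
    (sval (u false)).2.2 < (sval (u true)).2.1.
  case: nt => n [t tbig] /=.
  have [|u [uP ulr]] := @exists_children n.+1%:R^-1 t _ tbig.
    by rewrite invr_gt0.
  exists (fun b => exist (fun t => ~ countable (piece t)) (u b) (uP b).1); split=> // b.
  exact: (uP b).2.
have {step}[next nextP] := choice step.
pose T (f : nat -> bool) := fix T n : big :=
  if n is m.+1 then next (m, T m) (f m) else exist (fun t => ~ countable (piece t)) _ root_big.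
have TS f n : child n.+1%:R^-1 (sval (T f n)) (sval (T f n.+1)).
  exact: (nextP (n, T f n)).1.
pose lo f n := (sval (T f n)).2.1; pose hi f n := (sval (T f n)).2.2.
pose nd f n := (sval (T f n)).1.
have Tpt f n : piece (sval (T f n)) !=set0.
  by apply/set0P/eqP => e; apply: (svalP (T f n)); rewrite /= e.
have lohi f n : lo f n <= hi f n.
  have [z [_]] := Tpt f n; rewrite /= in_itv /= => /andP[]; exact: le_trans.
have lomono f m n : (m <= n)%N -> lo f m <= lo f n.
  move=> /subnK <-; elim: (n - m)%N => // k IH; apply: (le_trans IH).
  by rewrite addSn; have [] := TS f (k + m)%N.
have himono f m n : (m <= n)%N -> hi f n <= hi f m.
  move=> /subnK <-; elim: (n - m)%N => // k; apply: le_trans.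
  by rewrite addSn; have [] := TS f (k + m)%N.
have lohi2 f m n : lo f m <= hi f n.
  apply: (le_trans (lomono f _ _ (leq_maxl m n))).
  by apply: (le_trans (lohi f _)); apply: himono; rewrite leq_maxr.
pose h f := sup (range (lo f)).
have hlo f n : lo f n <= h f.
  apply: ub_le_sup; last by exists n.
  by exists (hi f 0%N) => _ [m _ <-].
have hhi f n : h f <= hi f n.
  by apply: ge_sup; [exists (lo f 0%N), 0%N|move=> _ [m _ <-]].
(* Level [n.+1] is the first whose sequence has an entry of index [n]. *)
pose y f n := nth 0%N (nd f n.+1) n.
have size_nd f n : size (nd f n) = n.
  elim: n => // n IH; have [[k e] _ _ _] := TS f n.
  by rewrite /nd e size_rcons -/(nd f n) IH.
have ndE f n : nd f n = mkseq (y f) n.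
  elim: n => // n IH; rewrite mkseqS -IH /y.
  have [[k e] _ _ _] := TS f n; rewrite /nd e -/(nd f n) nth_rcons size_nd.
  by rewrite ltnn eqxx.
exists h => [f g hfg|f]; last first.
  (* If [h f] were in a forbidden interval, that open interval would contain the whole interval of
     some level [m >= n]. The latter contains a point [z] of the piece, whose branch shares the
     prefix of length [n] and so must avoid the forbidden interval. *)
  exists (y f) => n k cnk Ux.
  have [e e0 eU] := open_ball_itv (@rat_itv_open R k) Ux.
  have [m nm me] : exists2 m, (n <= m)%N & hi f m - lo f m < e.
    pose m := (n + Num.bound e^-1)%N; exists m.+1; first by rewrite ltnW // ltnS leq_addr.
    have [_ _ _ /le_lt_trans] := TS f m; apply.
    rewrite invf_plt ?posrE ?ltr0n //.
    apply: (lt_le_trans (archi_boundP _)); first by rewrite invr_ge0 ltW.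
    by rewrite ler_nat /m leqW // leq_addl.
  have [z [[y' y's y'z]]] := Tpt f m; rewrite /= in_itv /= => /andP[loz zhi].
  apply: (y'z n k); last first.
    apply: eU; rewrite /= in_itv /=; apply/andP.
    have := hlo f m; have := hhi f m; rewrite /lo /hi in me *; split; lra.
  suff -> : mkseq y' n = mkseq (y f) n by [].
  have tk (w : nat -> nat) : mkseq w n = take n (mkseq w m).
    by rewrite /mkseq -map_take take_iota (minn_idPl nm).
  have {}y's : mkseq y' m = nd f m by rewrite -[in LHS](size_nd f m).
  by rewrite !tk y's ndE.
apply: contrapT => fg.
have exfg : exists n, f n != g n.
  apply: contrapT => no; apply: fg; apply/funext => n.
  by apply/eqP; apply: contraPT no => ?; case; exists n.
(* The paths share their node at the first difference [n] and then enter disjoint intervals. *)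
case: (ex_minnP exfg) => n fgn minn.
have Tfg : T f n = T g n.
  have : forall m, (m <= n)%N -> T f m = T g m.
    elim=> // m IH mn; rewrite /= IH ?(ltnW mn) //; congr next.
    by apply/eqP; apply: contraTT mn => /minn; rewrite -leqNgt.
  exact.
have [_ sep] := nextP (n, T g n).
have [lf hf lg hg] : [/\ lo f n.+1 <= h f, h f <= hi f n.+1,
  lo g n.+1 <= h g & h g <= hi g n.+1] by split.
move: fgn lf hf lg hg; rewrite /lo /hi /= Tfg hfg.
by case: (f n); case: (g n) => // _; lra.
Qed.

End cantor_scheme.

(** * Bernstein sets *)

Lemma exists_bernstein (R : realType) : exists C : set R, bernstein C.
Proof.
pose dec (f : nat -> bool) : seq nat -> nat -> Prop := fun s k => f (pickle (s, k)).
(* The Boolean asks for two points per coded set: [true] for the one put in the Bernstein set,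
   [false] for the one left out. *)
pose I := ({f | ~ countable (souslin R (dec f))} * bool)%type.
have [[[f uncf] b]|s sinj sZ] :=
    @injective_choice I R (fun i => souslin R (dec (sval i.1))).
  have [h hinj hZ] := souslin_uncountable_embed uncf.
  (* Prepending the Boolean to the code embeds [I] into [nat -> bool], hence into the coded set
     through [h]. *)
  exists (fun i => h (fun n => if n is m.+1 then sval i.1 m else i.2)) => [|i];
    last exact: hZ.
  move=> [[f1 u1] b1] [[f2 u2] b2] /hinj /= e.
  have -> : b1 = b2 by exact: (congr1 (@^~ 0%N) e).
  congr (_, _); apply: eq_exist => /=.
  by apply/funext => n; exact: (congr1 (@^~ n.+1) e).
exists [set x | exists f, x = s (f, true)] => Z /measurable_souslin[c Zc] uncZ.
pose f (n : nat) : bool :=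
  if @unpickle (seq nat * nat)%type n is Some p then `[< c p.1 p.2 >] else false.
have Zf : Z = souslin R (dec f).
  rewrite Zc; congr (souslin R); apply/funext => t; apply/funext => k.
  by rewrite /dec /f pickleK asboolE.
have unc : ~ countable (souslin R (dec f)) by rewrite -Zf.
pose i : {f | ~ countable (souslin R (dec f))} := exist _ f unc.
split.
  by exists (s (i, true)); split; [rewrite Zf; exact: (sZ (i, true))|exists i].
exists (s (i, false)); split; first by rewrite Zf; exact: (sZ (i, false)).
by move=> [j /sinj].
Qed.

Lemma bernsteinC (R : realType) (B : set R) : bernstein B -> bernstein (~` B).
Proof.
move=> bB Z mZ uncZ; have [ZB ZDB] := bB Z mZ uncZ.
by split; [rewrite -setDE|rewrite setDE setCK].
Qed.

(** On [[n, n + 1[] this is the translate by [n] of the trace of [C] on [[0, 1[] for even [n], and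
    of the trace of its complement for odd [n]. *)
Definition alternate (R : realType) (C : set R) : set R :=
  [set x | `[< C (x - (Num.floor x)%:~R) >] (+) odd `|Num.floor x|%N].

Lemma alternateD1 (R : realType) (C : set R) x :
  alternate C (x + 1) <-> ~ alternate C x.
Proof.
rewrite /alternate /=.
have -> : Num.floor (x + 1) = Num.floor x + 1.
  by rewrite floorDrz ?int_num1 // floor1.
have -> : x + 1 - (Num.floor x + 1)%:~R = x - (Num.floor x)%:~R.
  by rewrite intrD; lra.
have -> : odd `|(Num.floor x + 1)%R|%N = ~~ odd `|Num.floor x|%N.
  by case: (Num.floor x) => [n|[|n]] //=; rewrite ?addn1 ?NegzE //; lia.
by rewrite addbN; split=> /negP.
Qed.

Lemma alternate_bernstein (R : realType) (C : set R) :
  bernstein C -> bernstein (alternate C).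
Proof.
move=> bC Z mZ uncZ.
(* The trace of [Z] on [[n, n + 1[], moved back to [[0, 1[]. *)
pose unit_piece (n : int) := (fun x : R => x + n%:~R) @^-1` Z `&` `[0, 1[%classic.
have [n uncn] : exists n, ~ countable (unit_piece n).
  apply: contrapT => no; apply: uncZ.
  have -> : Z = \bigcup_(n in [set: int]) ((fun x : R => x + n%:~R) @` unit_piece n).
    apply/seteqP; split=> [x Zx|x [n _ [z [Zz _] <-]]] //.
    exists (Num.floor x) => //; exists (x - (Num.floor x)%:~R); last by rewrite subrK.
    split; first by rewrite /= subrK.
    by have := floor_itv x; rewrite intrD /= in_itv /= => /andP[? ?]; apply/andP; split; lra.
  apply: bigcup_countable => // n _.
  apply: (sub_countable (card_image_le _ _)).
  by apply: contrapT => nc; apply: no; exists n.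
have mn : measurable (unit_piece n).
  apply: measurableI => //; rewrite -[_ @^-1` _]setTI.
  suff mD : measurable_fun setT (fun x : R => x + n%:~R) by exact: mD.
  by apply: measurable_funD => //; exact: measurable_id.
have altE x : unit_piece n x -> alternate C (x + n%:~R) = `[< C x >] (+) odd `|n|%N.
  move=> [_ x01]; rewrite /alternate /=.
  have -> : Num.floor (x + n%:~R) = n.
    apply: floor_def; move: x01; rewrite intrD /= in_itv /= => /andP[? ?].
    by apply/andP; split; lra.
  by rewrite addrK.
have [[x [xn Cx]] [z [zn Cz]]] := bC _ mn uncn.
have {altE} [altx altz] := (altE _ xn, altE _ zn).
move: altx altz; rewrite (asboolT Cx) (asboolF Cz) /= => altx altz.
(* For odd [n] the points of the piece inside and outside [C] exchange roles. *)
case: (odd _) altx altz => /= altx altz.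
  split; [exists (z + n%:~R)|exists (x + n%:~R)]; split=> /=;
    by [case: zn|case: xn|rewrite altx|rewrite altz].
split; [exists (x + n%:~R)|exists (z + n%:~R)]; split=> /=;
    by [case: zn|case: xn|rewrite altx|rewrite altz].
Qed.

Lemma not_two_covering (R : realType) (A : set R) :
  (forall x, A x -> ~ A (x + 1)) -> ~ two_covering A.
Proof.
move=> A1 covA; have [|x xA] := covA [set 0; 1].
  apply: card_eq_trans (@card_II 2); apply/eq_cardSP; exists 0; first by left.
  have -> : [set 0; 1] `\ 0 = [set (1 : R)]; last exact: card_set1.
  apply/seteqP; split=> [z [[->|->] //] []//|z ->]; split; first by right.
  by apply/eqP; rewrite oner_eq0.
apply: (A1 x); apply: xA; first by exists 0; [left|rewrite add0r].
by exists 1; [right|rewrite addrC].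
Qed.

Theorem mainTheorem5 (R : realType) :
  exists A B : set R,
    A `|` B = setT /\ A `&` B = set0 /\
    bernstein A /\ bernstein B /\
    ~ two_covering A /\ ~ two_covering B.
Proof.
have [C /alternate_bernstein bA] := exists_bernstein R.
exists (alternate C), (~` alternate C); rewrite setUCr setICr; split=> //; split=> //.
split=> //; split; first exact: bernsteinC.
split; apply: not_two_covering => x; first by move=> Ax /alternateD1.
by move=> nAx; apply; apply/alternateD1.
Qed.
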